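(* For every real number $\gamma$ with $\frac12<\gamma<1$, there exists $\varepsilon_0=\varepsilon_0(\gamma)>0$ (depending only on $\gamma$) such that the following holds. If $0<\varepsilon<\varepsilon_0$, $p=1+\varepsilon$ and $q=1+\gamma\varepsilon$, then $$ \|\mathrm{T}^{1/4\to1/2} f\|_{p,1/2}\leq\|f\|_{q,1/4} $$ for every integer $n\geq1$ and every function $f:\{0,1\}^n\to\mathbb R$.
   Context: Subsets of $[n]=\{1,\dots,n\}$ are identified with their indicator vectors in $\{0,1\}^n$, so a function $f:\{0,1\}^n\to\mathbb R$ is also regarded as a function of subsets of $[n]$. For $0<\alpha<1$, $\mu_\alpha$ denotes the $\alpha$-biased product probability measure on $\{0,1\}^n$, i.e. $\mu_\alpha(x)=\alpha^{|x|}(1-\alpha)^{n-|x|}$, where $|x|$ is the number of coordinates of $x$ equal to $1$. For $r\ge1$, $\|f\|_{r,\alpha}=\left(\mathbb E_{\mu_\alpha}|f|^r\right)^{1/r}=\left(\sum_{x\in\{0,1\}^n}\mu_\alpha(x)|f(x)|^r\right)^{1/r}$. The one-sided noise operator $\mathrm{T}^{1/4\to1/2}$ acts on functions $f:\{0,1\}^n\to\mathbb R$ by $$ \mathrm{T}^{1/4\to1/2}f(T)=\frac{1}{2^{|T|}}\sum_{W\subseteq T}f(W)\qquad (T\subseteq[n]), $$ that is, $\mathrm{T}^{1/4\to1/2}f(T)=\mathbb E[f(W)\mid T]$, where $W\subseteq T$ is obtained by retaining each element of $T$ independently with probability $1/2$. *)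

(* Defs.v *)
From mathcomp Require Import all_boot all_order all_algebra.
From mathcomp Require Import reals exp.

Set Implicit Arguments.
Unset Strict Implicit.
Unset Printing Implicit Defensive.

Import Order.TTheory GRing.Theory Num.Theory.
Local Open Scope ring_scope.

(* The cube {0,1}^n is represented by the type {set 'I_n} of subsets of an
   n-element set, |x| being #|x|. *)

Definition biased_measure (R : realType) (n : nat) (alpha : R)
    (x : {set 'I_n}) : R :=
  alpha ^+ #|x| * (1 - alpha) ^+ (n - #|x|).

(* [powR] satisfies 0 `^ r = 0 for r != 0, so for r >= 1 zeros of f contribute
   nothing, as intended. *)
Definition biased_norm (R : realType) (n : nat) (r alpha : R)
    (f : {set 'I_n} -> R) : R :=
  (\sum_(x : {set 'I_n}) biased_measure alpha x * `|f x| `^ r) `^ (1 / r).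

(* The operator T^{1/4 -> 1/2}. *)
Definition one_sided_noise (R : realType) (n : nat) (f : {set 'I_n} -> R)
    (T : {set 'I_n}) : R :=
  1 / 2 ^+ #|T| * \sum_(W : {set 'I_n} | W \subset T) f W.

(* Main.v *)
Require Import Defs.
From mathcomp Require Import all_boot all_order all_algebra.
From mathcomp Require Import reals exp.
From mathcomp Require Import topology normedtype sequences derive realfun.
From mathcomp Require Import ring lra.

Import Order.TTheory GRing.Theory Num.Theory.
Import numFieldNormedType.Exports.
Local Open Scope ring_scope.

(** The inequality tensorizes: T is a product operator, and since p >= q
Minkowski's inequality in L^(p/q) reduces it, one coordinate at a time, to the
two-point inequality
  1/2 a^p + 1/2 ((a+b)/2)^p <= (3/4 a^q + 1/4 b^q)^(p/q),  a, b >= 0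
([two_point], [minkowski_sum], [one_sided_noise_tensor]).

For the two-point inequality, scale so that (3a+b)/4 = 1 and put a = 1-s,
(a+b)/2 = 1+s, b = 1+3s with -1/3 <= s <= 1. Let X be uniform on {1-s, 1+s},
and let Y be 1-s with probability 3/4 and 1+3s with probability 1/4; both have
mean 1. By Bernoulli's inequality it is enough that
E X^p - 1 <= (p/q) (E Y^q - 1). To first order in eps = p - 1 the two sides are
eps Ent(X) and gamma eps Ent(Y), where Ent(Z) = E(Z ln Z), so the heart of the
matter is the entropy inequality Ent(X) <= (1/2) Ent(Y) ([xlnx_two_point]). It
is an equality at s = 0 and at s = 1 (that is, a = 0), which is where 1/2 comes
from.

Passing from entropies to moments uniformly in s is the remaining difficulty,
because ln is singular at 0. Compare x^(1+d) pointwise with the gap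
x ln x - x + 1 between x ln x and its tangent at 1: the difference between
x^(1+d) - 1 - (1+d)(x-1) and d times this gap is x (e^u - 1 - u) with
u = d ln x. Hence it is nonnegative for every x >= 0 ([xlnx_gap_le_powR]), which
serves Y; on [0, 2], the range of X, it is at most 8 d^2 times the gap if
d <= 1/2 ([powR_le_xlnx_gap]). The total loss is the factor 1 + 8 eps, which the
assumption gamma > 1/2 absorbs as soon as 1 + 8 eps <= 2 gamma. *)

(** * Continuity and derivative of x ln x *)

(** With z = sqrt x, this is z^2 |ln (z^2)| <= 2 z, a form of ln (1/z) <= 1/z.
It gives the continuity of x ln x at 0. *)
Lemma norm_xlnx_le_sqrt (R : realType) (x : R) : x <= 1 ->
  `|x * ln x| <= 2 * Num.sqrt x.
Proof.
move=> x1; have [x0|x0] := leP x 0.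
  by rewrite ln0// mulr0 normr0 mulr_ge0// sqrtr_ge0.
set z := Num.sqrt x; have z0 : 0 < z by rewrite sqrtr_gt0.
have xE : x = z ^+ 2 by rewrite sqr_sqrtr// ltW.
have lx : ln x = ln z *+ 2 by rewrite xE lnXn.
have lx0 : ln x <= 0 by exact: ln_le0.
have : - ln z < z^-1.
  by rewrite -lnV// ln_sublinear// invr_gt0.
move=> lz; have zz : z * z^-1 = 1 by rewrite mulfV ?gt_eqF.
rewrite ler0_norm ?mulr_ge0_le0 ?(ltW x0)// lx xE.
have : z * z * - ln z <= z * z * z^-1 by rewrite ler_wpM2l ?mulr_ge0 ?ltW.
rewrite -[z * z * z^-1]mulrA zz; lra.
Qed.

(** Continuity holds on the whole line because [ln] vanishes on nonpositive
numbers. Having it at 0 lets the mean value theorem reach the endpoints of the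
range of s, where an argument of the logarithm vanishes. *)
Lemma continuous_xlnx (R : realType) : continuous (fun x : R => x * ln x).
Proof.
move=> x; have [x0|x0|->] := ltgtP x 0.
- apply: (@cvg_near_cst _ _ _ _ _ (nbhs_filter x)).
  near=> y; rewrite [in RHS]ln0 ?(ltW x0)// mulr0 ln0 ?mulr0//.
  by near: y; exact: lt_le_nbhsl.
- by apply: continuousM; [exact: cvg_id|exact: continuous_ln].
- rewrite /continuous_at mul0r; apply/norm_cvg0P.
  apply: (@squeeze_cvgr _ _ _ _ (fun=> 0) (fun y : R => 2 * Num.sqrt y)).
  + near=> y; rewrite normr_ge0/= norm_xlnx_le_sqrt//.
    by near: y; exact: (@lt_le_nbhsl _ 1 0).
  + exact: cvg_cst.
  + have cs : continuous (fun y : R => 2 * Num.sqrt y).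
      by move=> y; apply: cvgM; [exact: cvg_cst|exact: sqrt_continuous].
    by have := cs 0; rewrite /continuous_at sqrtr0 mulr0.
Unshelve. all: by end_near.
Qed.

Lemma is_derive_xlnx_affine (R : realType) (c d x : R) : 0 < c + d * x ->
  is_derive x 1 (fun y : R => (c + d * y) * ln (c + d * y))
    (d * (ln (c + d * x) + 1)).
Proof.
move=> x0.
have dl : is_derive x 1 (fun y : R => c + d * y) d.
  by apply: is_derive_eq; rewrite /GRing.scale/=; ring.
have dln := @is_derive1_comp R (@ln R) _ x _ _ (is_derive1_ln x0) dl.
apply: is_derive_eq.
rewrite /GRing.scale/=.
by field; rewrite gt_eqF.
Qed.

Lemma continuous_xlnx_affine (R : realType) (c d : R) :
  continuous (fun y : R => (c + d * y) * ln (c + d * y)).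
Proof.
move=> x; apply: (@continuous_comp _ _ _ (fun y : R => c + d * y) (fun z => z * ln z)).
  by apply: cvgD; [exact: cvg_cst|apply: cvgM; [exact: cvg_cst|exact: cvg_id]].
exact: continuous_xlnx.
Qed.

(** * The entropy inequality *)

(** The difference H of the two sides vanishes at 0 and at 1. Its derivative is
ln ((1+3s)^3 (1-s)) - ln ((1+s)^4), which has the sign of s k(s) for the cubic
k(s) = 1 + 3s - s^2 - 7s^3. For s < 0, k is positive and H decreases to
H(0) = 0. For s > 0, k(s)/s is decreasing, so k changes sign at most once,
from + to -; hence H first increases and then decreases to H(1) = 0. *)
Lemma xlnx_two_point (R : realType) (s : R) : - 1 / 3 <= s -> s <= 1 ->
  (1 - s) * ln (1 - s) + 4 * ((1 + s) * ln (1 + s)) <=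
  (1 + 3 * s) * ln (1 + 3 * s).
Proof.
move=> s3 s1.
pose g (c y : R) := (1 + c * y) * ln (1 + c * y).
pose H (y : R) : R := g 3 y - g (-1) y - 4 * g 1 y.
pose D (y : R) := 3 * ln (1 + 3 * y) + ln (1 - y) - 4 * ln (1 + y).
have HE y : H y = g 3 y - g (-1) y - 4 * g 1 y by [].
have Hc : continuous H.
  move=> y; apply: cvgB; first by apply: cvgB; exact: continuous_xlnx_affine.
  by apply: cvgM; [exact: cvg_cst|exact: continuous_xlnx_affine].
have HD (y : R) : - 1 / 3 < y < 1 -> is_derive y 1 H (D y).
  move=> /andP[y3 y1].
  have d3 : is_derive y 1 (g 3) (3 * (ln (1 + 3 * y) + 1)).
    by apply: is_derive_xlnx_affine; lra.
  have d1 : is_derive y 1 (g (-1)) ((-1) * (ln (1 + (-1) * y) + 1)).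
    by apply: is_derive_xlnx_affine; lra.
  have d4 : is_derive y 1 (g 1) (1 * (ln (1 + 1 * y) + 1)).
    by apply: is_derive_xlnx_affine; lra.
  apply: is_derive_eq.
  by rewrite /GRing.scale/= /D (mulN1r y) (mul1r y); ring.
have mvt (a b : R) : - 1 / 3 <= a -> a < b -> b <= 1 ->
    exists2 c, a < c < b & H b - H a = D c * (b - a).
  move=> a3 ab b1; have [||c] := @MVT R H D a b ab.
  - by move=> x; rewrite in_itv/= => /andP[ax xb]; apply: HD; lra.
  - exact: continuous_subspaceT.
  - by rewrite in_itv/= => ci e; exists c.
pose k (y : R) := 1 + 3 * y - y ^+ 2 - 7 * y ^+ 3.
have Dln (y : R) : - 1 / 3 < y < 1 ->
    D y = ln ((1 + 3 * y) ^+ 3 * (1 - y)) - ln ((1 + y) ^+ 4).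
  move=> /andP[y3 y1].
  have ? : 0 < 1 + 3 * y by lra.
  have ? : 0 < 1 - y by lra.
  have ? : 0 < 1 + y by lra.
  by rewrite lnM ?posrE ?exprn_gt0// !lnXn// /D; ring.
have kE (y : R) : (1 + 3 * y) ^+ 3 * (1 - y) - (1 + y) ^+ 4 = 4 * y * k y.
  by rewrite /k; ring.
have pos (y : R) : - 1 / 3 < y < 1 ->
    0 < (1 + 3 * y) ^+ 3 * (1 - y) /\ 0 < (1 + y) ^+ 4.
  by move=> /andP[y3 y1]; split; rewrite ?mulr_gt0 ?exprn_gt0//; lra.
have DN (y : R) : - 1 / 3 < y < 1 -> D y < 0 -> y * k y < 0.
  move=> yi; have [p1 p2] := pos _ yi.
  by rewrite Dln// subr_lt0 ltr_ln// -subr_lt0 kE; lra.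
have DP (y : R) : - 1 / 3 < y < 1 -> 0 < D y -> 0 < y * k y.
  move=> yi; have [p1 p2] := pos _ yi.
  by rewrite Dln// subr_gt0 ltr_ln// -subr_gt0 kE; lra.
have H0 : H 0 = 0 by rewrite HE /g !mulr0 !addr0 ln1; ring.
have H1 : H 1 = 0.
  rewrite HE /g !mulr1 subrr mul0r subr0 (_ : 1 + 3 = 2 ^+ 2 :> R); last by ring.
  by rewrite lnXn// (_ : 1 + 1 = 2 :> R); ring.
suff : 0 <= H s.
  by rewrite HE /g !mulN1r !mul1r; lra.
have [s0|s0|->] := ltgtP s 0; last by rewrite H0.
- have [c /andP[sc c0]] := mvt _ _ s3 s0 ler01.
  rewrite H0 !sub0r => e.
  have ci : - 1 / 3 < c < 1 by lra.
  have Dc : D c <= 0.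
    rewrite leNgt; apply/negP => /(DP _ ci).
    rewrite nmulr_rgt0// => kc.
    have : 0 <= k c.
      rewrite /k.
      (* k c = (1 + 3 c) + c^2 (- 7 c - 1), and both terms are nonnegative
         when c <= - 1 / 7. *)
      have [c7|c7] := leP c (- 1 / 7); last by nra.
      have : 0 <= c ^+ 2 * (- 7 * c - 1) by rewrite mulr_ge0 ?sqr_ge0//; lra.
      have : c ^+ 2 * c = c ^+ 3 by ring.
      lra.
    lra.
  have : 0 <= D c * s by rewrite mulr_le0// ltW.
  lra.
- move: s1; rewrite le_eqVlt => /predU1P[->|s1]; first by rewrite H1.
  (* If H s < 0, the derivative is negative at some u in ]0, s[ and positive at
     some v in ]s, 1[, contrary to the single sign change of k. *)
  rewrite leNgt; apply/negP => Hs.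
  have [|u /andP[u0 us]] := mvt 0 s _ s0 (ltW s1); first by lra.
  rewrite H0 !subr0 => eu.
  have [//|v /andP[sv v1] ev] := mvt s 1 s3 s1.
  have ku : k u < 0.
    rewrite -(pmulr_rlt0 (k u) u0); apply: DN; first by lra.
    by move: Hs; rewrite eu pmulr_llt0.
  have kv : 0 < k v.
    have v0 : 0 < v by lra.
    rewrite -(pmulr_rgt0 (k v) v0); apply: DP; first by lra.
    have : 0 < D v * (1 - s) by rewrite -ev H1; lra.
    by rewrite pmulr_lgt0// subr_gt0.
  have uv : u < v by lra.
  have v0 : 0 < v by lra.
  have : u * k v - v * k u =
      - ((v - u) * (1 + u * v + 7 * (u * v * (u + v)))).
    by rewrite /k; ring.
  have : 0 < (v - u) * (1 + u * v + 7 * (u * v * (u + v))).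
    rewrite mulr_gt0 ?subr_gt0// !addr_gt0 ?mulr_gt0// addr_gt0//.
  have : 0 < u * k v by rewrite mulr_gt0.
  have : v * k u < 0 by rewrite pmulr_rlt0.
  lra.
Qed.

(** * Comparison of powers with x ln x *)

(** The distance from x ln x down to its tangent line at 1. Its average over a
law of mean 1 is the entropy of that law. *)
Definition xlnx_gap {R : realType} (x : R) : R := x * ln x - x + 1.

(** Square the inequality 1 + v/2 <= e^(v/2), whose left side is nonnegative. *)
Lemma expR_ge1Dx_sqr4 (R : realType) (v : R) : - 2 <= v ->
  1 + v + v ^+ 2 / 4 <= expR v.
Proof.
move=> v2; have -> : expR v = expR (v / 2) ^+ 2.
  by rewrite -expRM_natl; congr expR; field.
have -> : 1 + v + v ^+ 2 / 4 = (1 + v / 2) ^+ 2 by field.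
by apply: lerXn2r; rewrite ?nnegrE ?expR_ge0 ?expR_ge1Dx//; lra.
Qed.

(** From e^(-u) >= 1 - u one gets e^u <= 1 / (1 - u). *)
Lemma expR_le1Dx_sqr2 (R : realType) (u : R) : u <= 1 / 2 ->
  expR u <= 1 + u + 2 * u ^+ 2.
Proof.
move=> u2; have e := expR_ge1Dx (- u).
have eK : expR u * expR (- u) = 1 by rewrite -expRD subrr expR0.
have u1 : 0 < 1 - u by lra.
have : expR u * (1 - u) <= 1.
  by rewrite -[leRHS]eK ler_wpM2l ?expR_ge0.
rewrite -ler_pdivlMr// => /le_trans; apply.
rewrite ler_pdivrMr//.
have -> : (1 + u + 2 * u ^+ 2) * (1 - u) = 1 + u ^+ 2 * (1 - 2 * u) by ring.
by rewrite lerDl mulr_ge0 ?sqr_ge0//; lra.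
Qed.

Lemma powR1DE (R : realType) (d x : R) : 0 < x ->
  x `^ (1 + d) = x * expR (d * ln x).
Proof.
by move=> x0; rewrite /powR gt_eqF// mulrDl mul1r expRD lnK.
Qed.

(** The linear terms of the power and of [xlnx_gap] match, leaving only the
second-order remainder of the exponential. *)
Lemma powR_sub_tangentE (R : realType) (d x : R) : 0 < x ->
  x `^ (1 + d) - 1 - (1 + d) * (x - 1) =
  d * xlnx_gap x + x * (expR (d * ln x) - 1 - d * ln x).
Proof. by move=> x0; rewrite powR1DE// /xlnx_gap; ring. Qed.

Lemma xlnx_gap_ge0 (R : realType) (x : R) : 0 <= x -> 0 <= xlnx_gap x.
Proof.
rewrite /xlnx_gap le_eqVlt => /predU1P[<-|x0]; first by rewrite mul0r; lra.
have := expR_ge1Dx (- ln x); rewrite expRN lnK// => h.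
have : x * (1 + - ln x) <= x * x^-1 by rewrite ler_wpM2l// ltW.
rewrite mulfV ?gt_eqF//; lra.
Qed.

(** The remainder is nonnegative because e^u >= 1 + u whatever the sign and
size of u; so the constant stays 1 even where ln x is very negative. *)
Lemma xlnx_gap_le_powR (R : realType) (d x : R) : 0 <= d -> 0 <= x ->
  d * xlnx_gap x <= x `^ (1 + d) - 1 - (1 + d) * (x - 1).
Proof.
move=> d0; rewrite le_eqVlt => /predU1P[<-|x0].
  by rewrite /xlnx_gap powR0 ?mul0r; lra.
rewrite powR_sub_tangentE// lerDl mulr_ge0 ?(ltW x0)//.
by have := expR_ge1Dx (d * ln x); lra.
Qed.

(** Bernoulli's inequality for real exponents, a by-product of the comparison
above. *)
Lemma bernoulli_powR (R : realType) (r x : R) : 1 <= r -> 0 <= x ->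
  1 + r * (x - 1) <= x `^ r.
Proof.
move=> r1 x0; have d0 : 0 <= r - 1 by lra.
have := xlnx_gap_le_powR _ _ _ d0 x0; rewrite (_ : 1 + (r - 1) = r); last by ring.
by have := mulr_ge0 d0 (xlnx_gap_ge0 _ _ x0); lra.
Qed.

(** With v = - ln x, this is v^2 <= 4 (e^v - 1 - v) multiplied by x; for x <= 2
one has v >= -1, within the range of [expR_ge1Dx_sqr4]. *)
Lemma xln_sqr_le_xlnx_gap (R : realType) (x : R) : 0 < x -> x <= 2 ->
  x * ln x ^+ 2 <= 4 * xlnx_gap x.
Proof.
move=> x0 x2; have l1 : ln x <= 1.
  by have := @le_ln1Dx R (x - 1); rewrite (_ : 1 + (x - 1) = x); [lra|ring].
have := @expR_ge1Dx_sqr4 R (- ln x); rewrite expRN lnK// => /(_ ltac:(lra)).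
move=> /(ler_wpM2l (ltW x0)); rewrite mulfV ?gt_eqF//.
rewrite /xlnx_gap sqrrN => h.
have -> : x * ln x ^+ 2 = 4 * (x * (1 + - ln x + ln x ^+ 2 / 4)) - 4 * x * (1 - ln x).
  by field.
lra.
Qed.

(** The remainder x (e^u - 1 - u) with u = e ln x <= 1/2 is at most
2 e^2 x (ln x)^2, hence at most 8 e^2 times the gap. *)
Lemma powR_le_xlnx_gap (R : realType) (e x : R) : 0 <= e -> e <= 1 / 2 ->
  0 <= x -> x <= 2 ->
  x `^ (1 + e) - 1 - (1 + e) * (x - 1) <= e * (1 + 8 * e) * xlnx_gap x.
Proof.
move=> e0 e2; rewrite le_eqVlt => /predU1P[<- _|x0 x2].
  by rewrite /xlnx_gap powR0 ?mul0r; nra.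
have l1 : ln x <= 1.
  by have := @le_ln1Dx R (x - 1); rewrite (_ : 1 + (x - 1) = x); [lra|ring].
rewrite powR_sub_tangentE//.
have u2 : e * ln x <= 1 / 2.
  by rewrite (le_trans _ e2)// -[leRHS]mulr1 ler_wpM2l.
have h1 : x * (expR (e * ln x) - 1 - e * ln x) <= x * (2 * (e * ln x) ^+ 2).
  by rewrite ler_wpM2l ?(ltW x0)//; have := expR_le1Dx_sqr2 _ _ u2; lra.
have h2 : 2 * e ^+ 2 * (x * ln x ^+ 2) <= 2 * e ^+ 2 * (4 * xlnx_gap x).
  by rewrite ler_wpM2l ?xln_sqr_le_xlnx_gap// mulr_ge0// sqr_ge0.
rewrite (_ : x * (2 * (e * ln x) ^+ 2) = 2 * e ^+ 2 * (x * ln x ^+ 2)) in h1; last by ring.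
have -> : e * (1 + 8 * e) * xlnx_gap x =
    e * xlnx_gap x + 2 * e ^+ 2 * (4 * xlnx_gap x) by ring.
lra.
Qed.

(** * The two-point inequality *)

(** The case of mean 1. Bernoulli's inequality linearizes the outer power
p/q; then the moments are compared with entropies. *)
Lemma two_point_mean1 (R : realType) (gamma e s : R) :
  1 / 2 < gamma -> gamma < 1 -> 0 < e -> e <= (2 * gamma - 1) / 8 ->
  - 1 / 3 <= s -> s <= 1 ->
  1 / 2 * (1 - s) `^ (1 + e) + 1 / 2 * (1 + s) `^ (1 + e) <=
  (3 / 4 * (1 - s) `^ (1 + gamma * e) + 1 / 4 * (1 + 3 * s) `^ (1 + gamma * e))
    `^ ((1 + e) / (1 + gamma * e)).
Proof.
move=> g2 g1 e0 eg s3 s1.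
set B := 3 / 4 * _ + _; set r := (1 + e) / _.
have ge0 : 0 < gamma * e by apply: mulr_gt0 => //; lra.
have r1 : 1 <= r.
  rewrite /r ler_pdivlMr ?mul1r ?lerD2l; last by lra.
  by rewrite ler_piMl ?ltW.
have B0 : 0 <= B by rewrite addr_ge0// mulr_ge0 ?powR_ge0//; lra.
apply: le_trans (bernoulli_powR _ _ _ r1 B0).
have a1 := @powR_le_xlnx_gap R e (1 - s) (ltW e0) ltac:(lra) ltac:(lra) ltac:(lra).
have a2 := @powR_le_xlnx_gap R e (1 + s) (ltW e0) ltac:(lra) ltac:(lra) ltac:(lra).
have b1 := @xlnx_gap_le_powR R (gamma * e) (1 - s) (ltW ge0) ltac:(lra).
have b2 := @xlnx_gap_le_powR R (gamma * e) (1 + 3 * s) (ltW ge0) ltac:(lra).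
have ent := xlnx_two_point _ _ s3 s1.
pose EX := 1 / 2 * xlnx_gap (1 - s) + 1 / 2 * xlnx_gap (1 + s).
pose EY := 3 / 4 * xlnx_gap (1 - s) + 1 / 4 * xlnx_gap (1 + 3 * s).
have EXY : EX <= 1 / 2 * EY by rewrite /EX /EY /xlnx_gap; lra.
have EY0 : 0 <= EY.
  by rewrite /EY addr_ge0// mulr_ge0 ?xlnx_gap_ge0//; lra.
have lA : 1 / 2 * (1 - s) `^ (1 + e) + 1 / 2 * (1 + s) `^ (1 + e)
    <= 1 + e * (1 + 8 * e) * EX by rewrite /EX; lra.
have lB : gamma * e * EY <= B - 1 by rewrite /EY /B; lra.
have c0 : 0 <= e * (1 + 8 * e) by apply: mulr_ge0; lra.
have l1 : e * (1 + 8 * e) * EX <= e * (1 + 8 * e) * (1 / 2 * EY).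
  by rewrite ler_wpM2l.
have l2 : e * (1 + 8 * e) * (1 / 2 * EY) <= gamma * e * EY.
  have : 0 <= (2 * gamma - 1 - 8 * e) * (e * EY).
    by rewrite mulr_ge0 ?mulr_ge0 ?(ltW e0)//; lra.
  lra.
have B1 : 0 <= B - 1 by rewrite (le_trans _ lB)// mulr_ge0// ltW.
have : B - 1 <= r * (B - 1) by rewrite ler_peMl.
lra.
Qed.

Lemma two_point_nneg (R : realType) (gamma e a b : R) :
  1 / 2 < gamma -> gamma < 1 -> 0 < e -> e <= (2 * gamma - 1) / 8 ->
  0 <= a -> 0 <= b ->
  1 / 2 * a `^ (1 + e) + 1 / 2 * ((a + b) / 2) `^ (1 + e) <=
  (3 / 4 * a `^ (1 + gamma * e) + 1 / 4 * b `^ (1 + gamma * e))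
    `^ ((1 + e) / (1 + gamma * e)).
Proof.
move=> g2 g1 e0 eg a0 b0.
have ge0 : 0 < gamma * e by apply: mulr_gt0 => //; lra.
pose M := (3 * a + b) / 4.
have [M0|M0] := leP M 0.
  have -> : a = 0 by move: M0; rewrite /M; lra.
  have -> : b = 0 by move: M0; rewrite /M; lra.
  rewrite addr0 mul0r powR0; last by apply: lt0r_neq0; lra.
  by rewrite !mulr0 addr0 powR_ge0.
(* M is the common mean of the two laws; dividing by it gives mean 1. *)
pose s := 1 - a / M.
have Mn0 : M != 0 by rewrite gt_eqF.
have MK (x : R) : M * (x / M) = x by rewrite mulrC divfK.
have aE : a = M * (1 - s) by rewrite /s -{1}(MK a); ring.
have bE : b = M * (1 + 3 * s).
  have -> : b = 4 * M - 3 * a by rewrite /M; field.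
  by rewrite {1}aE; ring.
have mE : (a + b) / 2 = M * (1 + s) by rewrite aE bE; field.
have s1 : s <= 1 by rewrite /s gerBl divr_ge0// ltW.
have s3 : - 1 / 3 <= s.
  have : 0 <= b / M by rewrite divr_ge0// ltW.
  by rewrite bE mulrC mulKf ?gt_eqF//; lra.
have := @two_point_mean1 R gamma e s g2 g1 e0 eg s3 s1.
pose A := 1 / 2 * (1 - s) `^ (1 + e) + 1 / 2 * (1 + s) `^ (1 + e).
pose B := 3 / 4 * (1 - s) `^ (1 + gamma * e)
  + 1 / 4 * (1 + 3 * s) `^ (1 + gamma * e).
rewrite -/A -/B => AB.
have MX (t x : R) : 0 <= x -> (M * x) `^ t = M `^ t * x `^ t.
  by move=> x0; rewrite powRM// ltW.
rewrite mE aE bE !MX; try lra.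
rewrite [leLHS](_ : _ = M `^ (1 + e) * A); last by rewrite /A; ring.
rewrite [X in _ <= X `^ _](_ : _ = M `^ (1 + gamma * e) * B); last first.
  by rewrite /B; ring.
have B0 : 0 <= B.
  by rewrite /B addr_ge0// mulr_ge0 ?powR_ge0//; lra.
have q0 : 1 + gamma * e != 0 by apply: lt0r_neq0; lra.
rewrite (powRM _ (powR_ge0 _ _) B0) -powRrM [(1 + gamma * e) * _]mulrC divfK//.
by rewrite ler_wpM2l ?powR_ge0.
Qed.

Lemma two_point (R : realType) (gamma e u v : R) :
  1 / 2 < gamma -> gamma < 1 -> 0 < e -> e <= (2 * gamma - 1) / 8 ->
  1 / 2 * `|u| `^ (1 + e) + 1 / 2 * `|(u + v) / 2| `^ (1 + e) <=
  (3 / 4 * `|u| `^ (1 + gamma * e) + 1 / 4 * `|v| `^ (1 + gamma * e))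
    `^ ((1 + e) / (1 + gamma * e)).
Proof.
move=> g2 g1 e0 eg.
apply: le_trans (two_point_nneg _ _ _ _ _ g2 g1 e0 eg (normr_ge0 u) (normr_ge0 v)).
rewrite lerD2l; apply: ler_wpM2l; first by lra.
apply: ge0_ler_powR; rewrite ?nnegrE ?divr_ge0 ?addr_ge0//; first by lra.
by rewrite normrM (@ger0_norm _ (2^-1 : R)) ?invr_ge0// ler_wpM2r ?invr_ge0// ler_normD.
Qed.

(** * Tensorization *)

(** Average Bernoulli's inequality at x/m and y/m, where m is the mean. *)
Lemma convex_powR2 (R : realType) (r t x y : R) : 1 <= r -> 0 <= t -> t <= 1 ->
  0 <= x -> 0 <= y ->
  (t * x + (1 - t) * y) `^ r <= t * x `^ r + (1 - t) * y `^ r.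
Proof.
move=> r1 t0 t1 x0 y0; set m := t * x + (1 - t) * y.
have t'0 : 0 <= 1 - t by lra.
have m0 : 0 <= m by rewrite addr_ge0// mulr_ge0.
have rhs0 : 0 <= t * x `^ r + (1 - t) * y `^ r.
  by rewrite addr_ge0// mulr_ge0// powR_ge0.
have [mE|mN0] := eqVneq m 0.
  by rewrite mE powR0//; apply: lt0r_neq0; lra.
have m_gt0 : 0 < m by rewrite lt_neqAle eq_sym mN0.
have mZ (z : R) : 0 <= z -> z `^ r = m `^ r * (z / m) `^ r.
  by move=> z0; rewrite -powRM ?divr_ge0// mulrC divfK.
rewrite (mZ x)// (mZ y)// ![_ * (m `^ r * _)]mulrCA -mulrDr.
rewrite -[leLHS]mulr1 ler_wpM2l ?powR_ge0//.
have bx := ler_wpM2l t0 (bernoulli_powR _ _ _ r1 (divr_ge0 x0 m0)).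
have byy := ler_wpM2l t'0 (bernoulli_powR _ _ _ r1 (divr_ge0 y0 m0)).
apply: le_trans (lerD bx byy).
rewrite le_eqVlt; apply/orP; left; apply/eqP.
have mm : t * (x / m) + (1 - t) * (y / m) = 1.
  by rewrite !mulrA -mulrDl -/m mulfV.
have -> : t * (1 + r * (x / m - 1)) + (1 - t) * (1 + r * (y / m - 1)) =
  1 + r * (t * (x / m) + (1 - t) * (y / m) - 1) by ring.
by rewrite mm subrr mulr0 addr0.
Qed.

(** Minkowski's inequality in L^r, with bounds on the norms in place of the
norms. It is the convexity of z^r with the weights cA/M and dB/M, M = cA + dB,
applied to U/A and V/B. When A or B is 0 the corresponding function vanishes
on P, because the weights w are positive. *)
Lemma minkowski_sum (R : realType) (I : finType) (P : pred I) (w U V : I -> R)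
    (r c d A B : R) :
  1 <= r -> 0 < c -> 0 < d -> (forall i, 0 < w i) ->
  (forall i, 0 <= U i) -> (forall i, 0 <= V i) -> 0 <= A -> 0 <= B ->
  \sum_(i | P i) w i * U i `^ r <= A `^ r ->
  \sum_(i | P i) w i * V i `^ r <= B `^ r ->
  \sum_(i | P i) w i * (c * U i + d * V i) `^ r <= (c * A + d * B) `^ r.
Proof.
move=> r1 c0 d0 w0 U0 V0 A0 B0 UA VB.
have r0 : r != 0 by apply: lt0r_neq0; lra.
have null (F : I -> R) : (forall i, 0 <= F i) ->
    \sum_(i | P i) w i * F i `^ r <= 0 `^ r -> forall i, P i -> F i = 0.
  move=> F0; rewrite powR0// => F_le0 i Pi.
  have T0 j : P j -> 0 <= w j * F j `^ r.
    by move=> _; rewrite mulr_ge0 ?powR_ge0// ltW.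
  have /eqP : \sum_(i | P i) w i * F i `^ r = 0.
    by apply: le_anti; rewrite F_le0 sumr_ge0//.
  rewrite psumr_eq0// => /allP/(_ i (mem_index_enum _)); rewrite Pi/=.
  by rewrite mulf_eq0 gt_eqF//= => /eqP/powR_eq0_eq0.
have scale (F : I -> R) (k C : R) : 0 < k -> (forall i, 0 <= F i) -> 0 <= C ->
    \sum_(i | P i) w i * F i `^ r <= C `^ r ->
    \sum_(i | P i) w i * (k * F i) `^ r <= (k * C) `^ r.
  move=> k0 F0 C0 FC; rewrite powRM ?(ltW k0)//.
  under eq_bigr do rewrite powRM ?(ltW k0)// mulrCA.
  by rewrite -mulr_sumr ler_wpM2l ?powR_ge0.
move: A0; rewrite le_eqVlt => /predU1P[A0|A0].
  rewrite -A0 mulr0 add0r (le_trans _ (scale _ _ _ d0 V0 B0 VB))//.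
  rewrite le_eqVlt; apply/orP; left; apply/eqP; apply: eq_bigr => i Pi.
  by rewrite (null _ U0 _ i Pi) ?mulr0 ?add0r// [in leRHS]A0.
move: B0; rewrite le_eqVlt => /predU1P[B0|B0].
  rewrite -B0 mulr0 addr0 (le_trans _ (scale _ _ _ c0 U0 (ltW A0) UA))//.
  rewrite le_eqVlt; apply/orP; left; apply/eqP; apply: eq_bigr => i Pi.
  by rewrite (null _ V0 _ i Pi) ?mulr0 ?addr0// [in leRHS]B0.
pose M := c * A + d * B; pose t := c * A / M.
have M0 : 0 < M by rewrite addr_gt0// mulr_gt0.
have t0 : 0 <= t by rewrite divr_ge0 ?mulr_ge0 ?ltW.
have t1 : t <= 1 by rewrite ler_pdivrMr// mul1r lerDl mulr_ge0 ?ltW.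
have tE : t * M = c * A by rewrite divfK// gt_eqF.
have split i : c * U i + d * V i = M * (t * (U i / A) + (1 - t) * (V i / B)).
  rewrite mulrDr ![M * (_ * _)]mulrA ![M * _]mulrC mulrBl tE mul1r /M.
  by field; rewrite !gt_eqF.
have cancel (F : I -> R) (C : R) : 0 < C -> (forall i, 0 <= F i) ->
    \sum_(i | P i) w i * F i `^ r <= C `^ r ->
    \sum_(i | P i) w i * (F i / C) `^ r <= 1.
  move=> C0 F0 FC.
  have -> : 1 = (C^-1 * C) `^ r by rewrite mulVf ?gt_eqF// powR1.
  under eq_bigr do rewrite [F _ / C]mulrC.
  by apply: scale => //; rewrite ?invr_gt0// ltW.
have sU := cancel _ _ A0 U0 UA; have sV := cancel _ _ B0 V0 VB.
apply: (@le_trans _ _ (M `^ r *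
    (t * \sum_(i | P i) w i * (U i / A) `^ r +
     (1 - t) * \sum_(i | P i) w i * (V i / B) `^ r))).
  rewrite !mulr_sumr -big_split/= mulr_sumr; apply: ler_sum => i Pi.
  have UA0 : 0 <= U i / A by rewrite divr_ge0// ltW.
  have VB0 : 0 <= V i / B by rewrite divr_ge0// ltW.
  have h := @convex_powR2 _ r t _ _ r1 t0 t1 UA0 VB0.
  rewrite split powRM ?(ltW M0)//; last first.
    by rewrite addr_ge0// mulr_ge0// subr_ge0.
  rewrite mulrCA ler_wpM2l ?powR_ge0//.
  by rewrite ![_ * (w i * _)]mulrCA -mulrDr ler_wpM2l// ltW.
rewrite -/M -[leRHS]mulr1 ler_wpM2l ?powR_ge0//.
have : t * \sum_(i | P i) w i * (U i / A) `^ r <= t * 1 by rewrite ler_wpM2l.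
have : (1 - t) * \sum_(i | P i) w i * (V i / B) `^ r <= (1 - t) * 1.
  by rewrite ler_wpM2l// subr_ge0.
lra.
Qed.

(** Splitting off the coordinate a: a subset of a |: S is x or a |: x. *)
Lemma sum_subsetU1 (V : nmodType) (T : finType) (a : T) (S : {set T})
    (F : {set T} -> V) : a \notin S ->
  \sum_(x : {set T} | x \subset a |: S) F x =
  \sum_(x : {set T} | x \subset S) (F x + F (a |: x)).
Proof.
move=> aS; rewrite big_split/= (bigID (fun x : {set T} => a \in x))/= addrC.
congr (_ + _).
  by apply: eq_bigl => x; rewrite -subsetD1 setU1K.
rewrite (reindex_onto (fun x => a |: x) (fun x => x :\ a))/=; last first.
  by move=> x /andP[_ ax]; rewrite setD1K.
apply: eq_bigl => x; rewrite setU11 andbT.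
apply/andP/idP => [[xS /eqP <-]|xS].
  by rewrite -(setU1K aS) setSD.
by rewrite setUS// setU1K// (contra (subsetP xS a)).
Qed.

(** The biased product measure on the subsets of S. Making the ground set a
subset of a fixed type allows the induction to add one element without
changing the type. *)
Definition cube_weight {R : realType} {T : finType} (alpha : R)
  (S x : {set T}) : R := alpha ^+ #|x| * (1 - alpha) ^+ (#|S| - #|x|).

Lemma cube_weightU1 (R : realType) (T : finType) (alpha : R) (a : T)
    (S x : {set T}) : a \notin S -> x \subset S ->
  cube_weight alpha (a |: S) x = (1 - alpha) * cube_weight alpha S x /\
  cube_weight alpha (a |: S) (a |: x) = alpha * cube_weight alpha S x.
Proof.
move=> aS xS; have ax : a \notin x by rewrite (contra (subsetP xS a)).
rewrite /cube_weight !cardsU1 aS ax !add1n subSS exprS mulrA; split=> //.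
by rewrite subSn ?subset_leq_card// exprS mulrCA.
Qed.

(** A random subset of a |: x contains a with probability 1/2. *)
Lemma one_sided_noiseU1 (R : realType) (n : nat) (f : {set 'I_n} -> R)
    (a : 'I_n) (x : {set 'I_n}) : a \notin x ->
  one_sided_noise f (a |: x) =
  (one_sided_noise f x + one_sided_noise (fun W => f (a |: W)) x) / 2.
Proof.
move=> ax; rewrite /one_sided_noise sum_subsetU1// big_split/= cardsU1 ax.
by rewrite add1n exprS; field; rewrite expf_neq0// pnatr_eq0.
Qed.

(** Induction on S. For a new element a, write f and g for the restrictions of
the function to the sets avoiding and containing a. The two-point inequality
at Tf(x), Tg(x) handles the coordinate a pointwise in x; Minkowski's inequality
with r = p/q, applied to |Tf|^q and |Tg|^q, moves the L^r norm over x inside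
the average over a, where the induction hypothesis applies. *)
Lemma one_sided_noise_tensor (R : realType) (p q : R) : 0 < q -> q <= p ->
  (forall u v : R, 1 / 2 * `|u| `^ p + 1 / 2 * `|(u + v) / 2| `^ p <=
    (3 / 4 * `|u| `^ q + 1 / 4 * `|v| `^ q) `^ (p / q)) ->
  forall (n : nat) (S : {set 'I_n}) (f : {set 'I_n} -> R),
  \sum_(x : {set 'I_n} | x \subset S)
    cube_weight (1 / 2) S x * `|one_sided_noise f x| `^ p <=
  (\sum_(x : {set 'I_n} | x \subset S)
    cube_weight (1 / 4) S x * `|f x| `^ q) `^ (p / q).
Proof.
move=> q0 qp two n S.
have qN0 : q != 0 by rewrite gt_eqF.
have qpK (z : R) : (z `^ q) `^ (p / q) = z `^ p.
  by rewrite -powRrM mulrC divfK.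
have r1 : 1 <= p / q by rewrite ler_pdivlMr// mul1r.
have [m] := ubnP #|S|; elim: m S => // m IH S; rewrite ltnS => Sm f.
have [S0|[a aS]] := set_0Vmem S.
  have sub0 (x : {set 'I_n}) : (x \subset S) = (x == set0).
    by rewrite S0 subset0.
  rewrite !(eq_bigl _ _ sub0) !big_pred1_eq S0 /cube_weight cards0 !expr0 !mul1r.
  by rewrite qpK /one_sided_noise cards0 (eq_bigl _ _ (@subset0 _)) big_pred1_eq
    expr0 divr1 mul1r.
set S' := S :\ a.
have aS' : a \notin S' by rewrite !inE eqxx.
have S'm : (#|S'| < m)%N by rewrite (leq_trans _ Sm)// [in ltnRHS](cardsD1 a) aS.
rewrite -(setD1K aS) -/S' !sum_subsetU1//.
pose g W := f (a |: W).
have hw (x : {set 'I_n}) : x \subset S' -> a \notin x.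
  by move=> xS; rewrite (contra (subsetP xS a)).
apply: (@le_trans _ _ (\sum_(x : {set 'I_n} | x \subset S')
    cube_weight (1 / 2) S' x * (3 / 4 * `|one_sided_noise f x| `^ q +
       1 / 4 * `|one_sided_noise g x| `^ q) `^ (p / q))).
  apply: ler_sum => x xS; rewrite one_sided_noiseU1 ?hw//.
  have [-> ->] := @cube_weightU1 R _ (1 / 2) a S' x aS' xS.
  apply: (le_trans _ (ler_wpM2l _ (two _ _))); last first.
    by rewrite /cube_weight mulr_ge0// exprn_ge0//; lra.
  by rewrite -/g le_eqVlt; apply/orP; left; apply/eqP; field.
rewrite [X in _ <= X `^ _](_ : _ =
    3 / 4 * (\sum_(x : {set 'I_n} | x \subset S')
      cube_weight (1 / 4) S' x * `|f x| `^ q) +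
    1 / 4 * (\sum_(x : {set 'I_n} | x \subset S')
      cube_weight (1 / 4) S' x * `|g x| `^ q)).
  apply: minkowski_sum => //.
  - lra.
  - lra.
  - by move=> x; rewrite /cube_weight mulr_gt0// exprn_gt0//; lra.
  - by move=> x; rewrite powR_ge0.
  - by move=> x; rewrite powR_ge0.
  - apply: sumr_ge0 => x _; rewrite mulr_ge0 ?powR_ge0//.
    by rewrite /cube_weight mulr_ge0// exprn_ge0//; lra.
  - apply: sumr_ge0 => x _; rewrite mulr_ge0 ?powR_ge0//.
    by rewrite /cube_weight mulr_ge0// exprn_ge0//; lra.
  - by under eq_bigr do rewrite qpK; exact: IH.
  - by under eq_bigr do rewrite qpK; exact: IH.
rewrite !mulr_sumr -big_split/=; apply: eq_bigr => x xS.
have [-> ->] := @cube_weightU1 R _ (1 / 4) a S' x aS' xS.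
by rewrite -/(g x); field.
Qed.

Theorem theorem1p2 (R : realType) (gamma : R)
    (hgamma : 1 / 2 < gamma) (hgamma1 : gamma < 1) :
  exists eps0 : R, 0 < eps0 /\
    forall eps p q : R, 0 < eps -> eps < eps0 ->
      p = 1 + eps -> q = 1 + gamma * eps ->
      forall (n : nat) (f : {set 'I_n} -> R), (1 <= n)%N ->
        biased_norm p (1 / 2) (one_sided_noise f) <= biased_norm q (1 / 4) f.
Proof.
exists ((2 * gamma - 1) / 8); split; first by lra.
move=> eps p q e0 e_lt pE qE n f _.
have ge0 : 0 < gamma * eps by apply: mulr_gt0 => //; lra.
have qp : q <= p by rewrite pE qE lerD2l ler_piMl// ltW.
have q0 : 0 < q by rewrite qE; lra.
have p0 : 0 < p by rewrite pE; lra.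
have two (u v : R) : 1 / 2 * `|u| `^ p + 1 / 2 * `|(u + v) / 2| `^ p <=
    (3 / 4 * `|u| `^ q + 1 / 4 * `|v| `^ q) `^ (p / q).
  by rewrite pE qE; apply: two_point => //; exact: ltW.
have := @one_sided_noise_tensor R p q q0 qp two n [set: 'I_n] f.
have full (alpha r : R) (h : {set 'I_n} -> R) :
    \sum_(x : {set 'I_n} | x \subset [set: 'I_n])
      cube_weight alpha [set: 'I_n] x * `|h x| `^ r =
    \sum_(x : {set 'I_n}) biased_measure alpha x * `|h x| `^ r.
  apply: eq_big => [x|x _]; first by rewrite subsetT.
  by rewrite /cube_weight cardsT card_ord.
rewrite !full /biased_norm; set X := \sum_x _; set Y := \sum_x _ => XY.
have X0 : 0 <= X.
  apply: sumr_ge0 => x _; rewrite mulr_ge0 ?powR_ge0//.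
  by rewrite /biased_measure mulr_ge0// exprn_ge0//; lra.
have -> : Y `^ (1 / q) = (Y `^ (p / q)) `^ (1 / p).
  by rewrite -powRrM; congr powR; field; rewrite !gt_eqF.
apply: ge0_ler_powR; rewrite ?nnegrE ?powR_ge0 ?divr_ge0//; exact: ltW.
Qed.
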